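(* Let $n$ be a positive integer, $c,x_*\in\mathbb{R}^n$, $d\in\mathbb{R}$, $\delta\ge0$, let $M\in\mathbb{R}^{n\times n}$ be positive definite, and let $f:\mathbb{R}^n\to\mathbb{R}$ be defined by $$f(x)=c^Tx+d-\sqrt{\delta^2+(x-x_* )^TM(x-x_* )}.$$ Then $f$ is bounded above if and only if $c^TM^{-1}c\le1$. More specifically: (1) if $c^TM^{-1}c<1$ and $\delta=0$, then $x_*$ is the unique critical point of $f$, and $f(x_* )=c^Tx_*+d$ is the global maximum value of $f$; (2) if $c^TM^{-1}c=1$ and $\delta=0$, then every point in the ray $\{x_*+tM^{-1}c\mid t\ge0\}$ is a critical point of $f$, and on this ray $f$ attains its maximum value $f(x_* )=c^Tx_*+d$; (3) if $c^TM^{-1}c>1$ and $\delta=0$, then $x_*$ is the unique critical point of $f$, but $f$ is not bounded above; (4) if $c^TM^{-1}c<1$ and $\delta>0$, then $x_{cp}:=x_*+\dfrac{\delta M^{-1}c}{\sqrt{1-c^TM^{-1}c}}$ is the unique critical point of $f$, and $f(x_{cp})=c^Tx_*+d-\delta\sqrt{1-c^TM^{-1}c}$ is the global maximum value of $f$; (5) if $c^TM^{-1}c=1$ and $\delta>0$, then $f$ has no critical points and $f$ does not have a global maximum value, but $f$ is bounded above by $c^Tx_*+d$; (6) if $c^TM^{-1}c>1$ and $\delta>0$, then $f$ has no critical points and $f$ is not bounded above.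
   Context: A positive definite matrix is a real symmetric matrix with all eigenvalues positive. A critical point of $f$ is a point at which either $f$ is not differentiable or $\nabla f=0$. *)

(* Defs.v *)
From HB Require Import structures.
From mathcomp Require Import all_boot all_order all_algebra.
From mathcomp Require Import all_classical all_reals all_analysis.

Set Implicit Arguments.
Unset Strict Implicit.
Unset Printing Implicit Defensive.

Import Order.TTheory GRing.Theory Num.Theory.
Import numFieldNormedType.Exports.

Local Open Scope classical_set_scope.
Local Open Scope ring_scope.

(* Vectors of R^n are the column vectors 'cV[R]_n; the normed structure that
   MathComp-Analysis puts on them is the sup norm, which gives the same
   differentiability as the Euclidean norm. *)

(* [eigenvalue M] only sees eigenvalues lying in R; a symmetric real matrix has
   no others. *)
Definition posdef (R : realType) (n : nat) (M : 'M[R]_n) : Prop :=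
  M^T = M /\ forall a : R, eigenvalue M a -> 0 < a.

Definition gradient (R : realType) (n : nat) (f : 'cV[R]_n -> R)
    (x : 'cV[R]_n) : 'cV[R]_n :=
  \col_i 'D_(delta_mx i 0) f x.

Definition critical_point (R : realType) (n : nat) (f : 'cV[R]_n -> R)
    (x : 'cV[R]_n) : Prop :=
  ~ differentiable f x \/ gradient f x = 0.

Definition bounded_above (T : Type) (R : realType) (f : T -> R) : Prop :=
  has_ubound (range f).

Definition global_max_value (T : Type) (R : realType) (f : T -> R) (v : R)
    : Prop :=
  range f v /\ ubound (range f) v.

(* The scalar u^T v, as the unique entry of the 1 x 1 matrix product. *)
Definition dotv (R : realType) (n : nat) (u v : 'cV[R]_n) : R :=
  (u^T *m v) 0 0.

(* Main.v *)
Require Import Defs.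
From mathcomp Require Import all_boot all_order all_algebra.
From mathcomp Require Import all_classical all_reals all_analysis.
From mathcomp Require Import ring lra.

Import Order.TTheory GRing.Theory Num.Theory.
Import numFieldNormedType.Exports.

Local Open Scope classical_set_scope.
Local Open Scope ring_scope.

(** Write w = M^-1 c, B(u, v) = u^T M v and q = c^T w.  A symmetric matrix with
    positive eigenvalues makes B an inner product: the minimum of B(u, u) on
    the unit sphere exists by compactness, and a minimiser is an eigenvector
    whose eigenvalue is that minimum ([posdef_gt0]).  Since c^T u = B(w, u) and
    q = B(w, w), translating the origin to x_* gives
      f(x_* + u) = f_0 + B(w, u) - sqrt (delta^2 + B(u, u)),
    with f_0 = c^T x_* + d ([hyper_shift]), so that f depends on u only through
    its B-geometry relative to w.

    Upper bound, for q <= 1.  Cauchy-Schwarz for B gives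
    B(w, u) <= sqrt q * sqrt (B(u, u)), and Cauchy-Schwarz in the plane, against
    the unit vector (sqrt q, sqrt (1 - q)), gives
      sqrt q * sqrt (B(u, u)) + sqrt (1 - q) * delta
        <= sqrt (delta^2 + B(u, u)).
    Together f <= f_0 - delta * sqrt (1 - q) ([hyper_le]).

    Behaviour on the line u = t w, where f is f_0 + t q - sqrt (delta^2 + t^2 q)
    ([hyper_ray]).  For q > 1 it grows like t (q - sqrt q), whence unboundedness
    ([hyper_unbounded]).  For q = 1 and delta > 0 it tends to f_0, while
    f < f_0 everywhere, so no maximum is attained ([hyper_no_max]).

    Critical points.  Where the square root, say s, is nonzero, f is
    differentiable with gradient c - s^-1 M u, which vanishes exactly when
    u = s w ([critical_hyper]).  Then s^2 = delta^2 + s^2 q, so these critical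
    points are the x_* + s w with s > 0 and s^2 (1 - q) = delta^2
    ([critical_hyper_ray], [critical_hyper_on_ray]): a single s if q < 1 and
    delta > 0, every s if q = 1 and delta = 0, and none in the other cases.  The
    square root vanishes only at x_* and only when delta = 0; there f restricted
    to a line contains a nonzero multiple of the absolute value, so x_* is a
    critical point by failure of differentiability
    ([hyper_not_differentiable]).  The theorem combines these facts. *)

Set Implicit Arguments.
Unset Strict Implicit.

(** * The scalar product and quadratic forms *)

Lemma dotvE (R : realType) (n : nat) (u v : 'cV[R]_n) :
  dotv u v = \sum_i u i 0 * v i 0.
Proof. by rewrite /dotv mxE; apply: eq_bigr => i _; rewrite mxE. Qed.

Lemma dotvC (R : realType) (n : nat) (u v : 'cV[R]_n) : dotv u v = dotv v u.
Proof. by rewrite !dotvE; apply: eq_bigr => i _; rewrite mulrC. Qed.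

Lemma dotvDl (R : realType) (n : nat) (u v w : 'cV[R]_n) :
  dotv (u + v) w = dotv u w + dotv v w.
Proof. by rewrite /dotv linearD mulmxDl mxE. Qed.

Lemma dotvZl (R : realType) (n : nat) (a : R) (u v : 'cV[R]_n) :
  dotv (a *: u) v = a * dotv u v.
Proof. by rewrite /dotv linearZ -scalemxAl mxE. Qed.

Lemma dotvDr (R : realType) (n : nat) (u v w : 'cV[R]_n) :
  dotv u (v + w) = dotv u v + dotv u w.
Proof. by rewrite dotvC dotvDl !(dotvC u). Qed.

Lemma dotvZr (R : realType) (n : nat) (a : R) (u v : 'cV[R]_n) :
  dotv u (a *: v) = a * dotv u v.
Proof. by rewrite dotvC dotvZl dotvC. Qed.

Lemma dotv0r (R : realType) (n : nat) (u : 'cV[R]_n) : dotv u 0 = 0.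
Proof. by rewrite -(scale0r u) dotvZr mul0r. Qed.

Lemma dotv_sym (R : realType) (n : nat) (M : 'M[R]_n) (u v : 'cV[R]_n) :
  M^T = M -> dotv u (M *m v) = dotv v (M *m u).
Proof. by move=> MT; rewrite dotvC /dotv trmx_mul MT mulmxA. Qed.

Lemma dotv_delta (R : realType) (n : nat) (u : 'cV[R]_n) i :
  dotv u (delta_mx i 0) = u i 0.
Proof.
rewrite dotvE (bigD1 i) //= !mxE !eqxx mulr1 big1 ?addr0 // => j ji.
by rewrite mxE (negbTE ji) mulr0.
Qed.

Lemma dotv_eq0 (R : realType) (n : nat) (u : 'cV[R]_n) :
  dotv u u = 0 -> u = 0.
Proof.
rewrite dotvE => /psumr_eq0P H; apply/matrixP => i j; rewrite ord1 mxE.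
have /eqP := H (fun i _ => sqr_ge0 (u i 0)) i isT.
by rewrite mulf_eq0 orbb => /eqP.
Qed.

Lemma quad_lincomb (R : realType) (n : nat) (M : 'M[R]_n) (a b : R)
    (u v : 'cV[R]_n) :
  M^T = M -> dotv (a *: u + b *: v) (M *m (a *: u + b *: v)) =
  a ^+ 2 * dotv u (M *m u) + 2 * a * b * dotv u (M *m v)
    + b ^+ 2 * dotv v (M *m v).
Proof.
move=> MT; rewrite mulmxDr -!scalemxAr !(dotvDl, dotvDr, dotvZl, dotvZr).
rewrite (dotv_sym v u) //; ring.
Qed.

(** Semidefiniteness is tested on the vectors C u - b v and b u - A v, where
    A, C are the values of the form at u, v and b pairs them; this gives the
    inequality multiplied by C and by A.  The remaining case A = C = 0 is
    settled by u - b v.  Allowing a degenerate form matters in [posdef_gt0],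
    where the form vanishes at an eigenvector. *)
Lemma psd_cauchy_schwarz (R : realType) (n : nat) (M : 'M[R]_n)
    (u v : 'cV[R]_n) :
  M^T = M -> (forall x, 0 <= dotv x (M *m x)) ->
  dotv u (M *m v) ^+ 2 <= dotv u (M *m u) * dotv v (M *m v).
Proof.
move=> MT psd; set b := dotv u _.
have := psd u; have := psd v.
have := psd (dotv v (M *m v) *: u + (- b) *: v).
have := psd (b *: u + (- dotv u (M *m u)) *: v).
have := psd (1 *: u + (- b) *: v).
rewrite !quad_lincomb // -/b.
set A := dotv u _; set C := dotv v _ => h1 h2 h3 C0 A0.
have {}h2 : 0 <= A * (A * C - b ^+ 2) by move: h2; congr (_ <= _); ring.
have {}h3 : 0 <= C * (A * C - b ^+ 2) by move: h3; congr (_ <= _); ring.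
rewrite -subr_ge0; move: A0; rewrite le_eqVlt => /predU1P[A0|A0]; last first.
  by rewrite -(pmulr_rge0 _ A0).
move: C0; rewrite le_eqVlt => /predU1P[C0|C0]; last first.
  by rewrite -(pmulr_rge0 _ C0).
by move: h1; rewrite -A0 -C0; nra.
Qed.

(** The inner map [h] lets one lemma serve both for the translate x - x_* on
    columns and for transposition, since compact sets are studied on rows and
    the form is evaluated on columns. *)
Lemma quad_differentiable (R : realType) (V : normedModType R) (n : nat)
    (M : 'M[R]_n) (h : V -> 'cV[R]_n) (x : V) :
  (forall i, differentiable (fun y => h y i 0) x) ->
  differentiable (fun y => dotv (h y) (M *m h y)) x.
Proof.
move=> dh.
have -> : (fun y => dotv (h y) (M *m h y)) =
    \sum_(i < n) (fun y => h y i 0) *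
                 \sum_(j < n) (fun y => M i j *: h y j 0).
  apply/funext => y; rewrite dotvE fct_sumE; apply: eq_bigr => i _.
  by rewrite mxE /= [RHS]/(_ * _) fct_sumE.
apply: differentiable_sum => i; apply: differentiableM => //.
by apply: differentiable_sum => j; apply: differentiableZ.
Qed.

Lemma sphere_compact (R : realType) (n : nat) :
  compact [set v : 'rV[R]_n | dotv v^T v^T = 1].
Proof.
apply: bounded_closed_compact.
  exists 1; split=> // r r1 v /= v1; apply: le_trans (ltW r1).
  rewrite /Num.norm /= mx_normrE; apply/bigmax_leP; split=> // -[i j] _ /=.
  rewrite -(@expr_le1 _ 2) // real_normK ?num_real // -v1 ord1.
  rewrite dotvE (bigD1 j) //= !mxE -expr2 lerDl sumr_ge0 // => k _.
  exact: sqr_ge0.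
have c : continuous (fun v : 'rV[R]_n => dotv v^T (1%:M *m v^T)).
  move=> v; apply: differentiable_continuous; apply: quad_differentiable => i.
  under eq_fun do rewrite mxE.
  exact: differentiable_coord.
have -> : [set v : 'rV[R]_n | dotv v^T v^T = 1] =
   (fun v : 'rV[R]_n => dotv v^T (1%:M *m v^T)) @^-1` [set x | x = 1].
  by apply/seteqP; split=> v /=; rewrite mul1mx.
apply: preimage_closed; last exact: closed_eq.
by move=> v _; exact: c.
Qed.

(** The form attains a minimum l on the unit sphere, at v say.  Then M - l is
    positive semidefinite by homogeneity, and its form vanishes at v, so by
    Cauchy-Schwarz v pairs to zero with everything: (M - l) v = 0.  Thus l is an
    eigenvalue of M, hence positive, and u^T M u >= l |u|^2. *)
Lemma posdef_gt0 (R : realType) (n : nat) (M : 'M[R]_n) (u : 'cV[R]_n) :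
  posdef M -> u != 0 -> 0 < dotv u (M *m u).
Proof.
move=> [MT Meig] u0.
have sq_gt0 (x : 'cV[R]_n) : x != 0 -> 0 < dotv x x.
  move=> x0; rewrite lt_def; apply/andP; split.
    by apply: contra_neq x0; exact: dotv_eq0.
  by rewrite dotvE sumr_ge0 // => i _; exact: sqr_ge0.
have normalized (x : 'cV[R]_n) : x != 0 ->
    let y := (Num.sqrt (dotv x x))^-1 *: x in dotv y y = 1.
  move=> x0 /=; rewrite dotvZl dotvZr mulrA -invfM -expr2 sqr_sqrtr.
    by rewrite mulVf // gt_eqF // sq_gt0.
  by rewrite ltW // sq_gt0.
have [||v /set_mem /= v1 vmin] :=
  @compact_EVT_min _ R (fun v : 'rV[R]_n => dotv v^T (M *m v^T)) _ _
    (@sphere_compact R n).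
- exists ((Num.sqrt (dotv u u))^-1 *: u)^T => /=.
  by rewrite trmxK normalized.
- apply: continuous_subspaceT => v; apply: differentiable_continuous.
  apply: quad_differentiable => i; under eq_fun do rewrite mxE.
  exact: differentiable_coord.
set l := dotv v^T (M *m v^T) in vmin.
pose N := M - l%:M.
have NT : N^T = N by rewrite linearB /= MT tr_scalar_mx.
have NE x : dotv x (N *m x) = dotv x (M *m x) - l * dotv x x.
  by rewrite mulmxBl mul_scalar_mx -scaleNr dotvDr dotvZr mulNr.
have Npsd x : 0 <= dotv x (N *m x).
  have [->|x0] := eqVneq x 0; first by rewrite mulmx0 dotv0r.
  have /vmin : ((Num.sqrt (dotv x x))^-1 *: x)^T \in
      [set v : 'rV[R]_n | dotv v^T v^T = 1].
    by rewrite inE /= trmxK normalized.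
  rewrite trmxK -scalemxAr dotvZl dotvZr mulrA -invfM -expr2.
  rewrite sqr_sqrtr ?(ltW (sq_gt0 _ x0)) //.
  by rewrite mulrC ler_pdivlMr ?sq_gt0 // NE subr_ge0.
have Nv : N *m v^T = 0.
  apply: dotv_eq0; apply/eqP; rewrite -sqrf_eq0 eq_le sqr_ge0 andbT.
  apply: le_trans (psd_cauchy_schwarz _ _ NT Npsd) _.
  by rewrite (NE v^T) v1 mulr1 subrr mulr0.
have l_gt0 : 0 < l.
  apply: Meig; apply/eigenvalueP; exists v; last first.
    apply/eqP => v0; move: v1; rewrite v0 trmx0 dotv0r => /esym/eqP.
    by rewrite oner_eq0.
  move/eqP: Nv; rewrite mulmxBl mul_scalar_mx subr_eq0 => /eqP /(congr1 trmx).
  by rewrite trmx_mul trmxK MT linearZ /= trmxK.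
apply: lt_le_trans (mulr_gt0 l_gt0 (sq_gt0 _ u0)) _.
by rewrite -subr_ge0 -NE.
Qed.

Lemma posdef_ge0 (R : realType) (n : nat) (M : 'M[R]_n) (u : 'cV[R]_n) :
  posdef M -> 0 <= dotv u (M *m u).
Proof.
move=> pM; have [->|u0] := eqVneq u 0; first by rewrite mulmx0 dotv0r.
exact/ltW/posdef_gt0.
Qed.

Lemma posdef_unitmx (R : realType) (n : nat) (M : 'M[R]_n) :
  posdef M -> M \in unitmx.
Proof.
move=> [_ pM]; rewrite -row_free_unit -kermx_eq0; apply/contraT => k0.
have : eigenvalue M 0.
  rewrite /eigenvalue /eigenspace.
  by rewrite (_ : M - 0%:M = M) // (raddf0 (@scalar_mx R n)) subr0.
by move/pM; rewrite ltxx.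
Qed.

Lemma posdef_cauchy_schwarz (R : realType) (n : nat) (M : 'M[R]_n)
    (u v : 'cV[R]_n) : posdef M ->
  dotv u (M *m v) <=
    Num.sqrt (dotv u (M *m u)) * Num.sqrt (dotv v (M *m v)).
Proof.
move=> pM; rewrite -sqrtrM ?posdef_ge0 //; apply: le_trans (ler_norm _) _.
rewrite -sqrtr_sqr ler_wsqrtr //; apply: psd_cauchy_schwarz; first by case: pM.
by move=> x; exact: posdef_ge0.
Qed.

(** * Derivatives of the function *)

(** The function f of the theorem; its graph is a linear shear of one sheet of
    a hyperboloid, or of a half-cone when delta = 0. *)
Definition hyper (R : realType) (n : nat) (c xs : 'cV[R]_n) (d delta : R)
    (M : 'M[R]_n) (x : 'cV[R]_n) : R :=
  dotv c x + d - Num.sqrt (delta ^+ 2 + dotv (x - xs) (M *m (x - xs))).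

(** With w = M^-1 c, symmetry of M turns c^T u into w^T M u, so the whole
    function is expressed by the inner product that M defines. *)
Lemma hyper_shift (R : realType) (n : nat) (c xs : 'cV[R]_n) (d delta : R)
    (M : 'M[R]_n) (u : 'cV[R]_n) : posdef M ->
  hyper c xs d delta M (xs + u) = dotv c xs + d
    + (dotv (invmx M *m c) (M *m u)
       - Num.sqrt (delta ^+ 2 + dotv u (M *m u))).
Proof.
move=> pM; rewrite /hyper (addrC xs) addrK dotvDr.
rewrite (dotv_sym (invmx M *m c)) ?mulKVmx ?posdef_unitmx //; last by case: pM.
rewrite (dotvC u c); ring.
Qed.

Lemma dotv_differentiable (R : realType) (n : nat) (c x : 'cV[R]_n) :
  differentiable (dotv c) x.
Proof.
have -> : dotv c = \sum_(i < n) (fun z : 'cV[R]_n => c i 0 *: z i 0).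
  by apply/funext => z; rewrite dotvE fct_sumE.
apply: differentiable_sum => i; apply: differentiableZ.
exact: differentiable_coord.
Qed.

Lemma hyper_differentiable (R : realType) (n : nat) (c xs : 'cV[R]_n)
    (d delta : R) (M : 'M[R]_n) (x : 'cV[R]_n) :
  0 < delta ^+ 2 + dotv (x - xs) (M *m (x - xs)) ->
  differentiable (hyper c xs d delta M) x.
Proof.
move=> r0.
pose Q z := dotv (z - xs) (M *m (z - xs)).
have dQ : differentiable Q x.
  apply: quad_differentiable => i.
  have -> : (fun z : 'cV[R]_n => (z - xs) i 0) =
      (fun z => z i 0) - cst (xs i 0).
    by apply/funext => z; rewrite !mxE.
  apply: differentiableB; last exact: differentiable_cst.
  exact: differentiable_coord.
have -> : hyper c xs d delta M =
  (dotv c + cst d) - (Num.sqrt \o (cst (delta ^+ 2) + Q)) by [].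
apply: differentiableB.
  apply: differentiableD; last exact: differentiable_cst.
  exact: dotv_differentiable.
apply: differentiable_comp.
  by apply: differentiableD => //; exact: differentiable_cst.
apply/derivable1_diffP.
by case: (is_derive1_sqrt r0).
Qed.

(** Along the line through x_* + u directed by v, the radicand is a quadratic
    polynomial in the parameter, so the one-variable chain rule for the square
    root suffices. *)
Lemma hyper_derive (R : realType) (n : nat) (c xs : 'cV[R]_n)
    (d delta : R) (M : 'M[R]_n) (u v : 'cV[R]_n) : posdef M ->
  0 < delta ^+ 2 + dotv u (M *m u) ->
  'D_v (hyper c xs d delta M) (xs + u) =
    dotv c v - dotv v (M *m u) / Num.sqrt (delta ^+ 2 + dotv u (M *m u)).
Proof.
move=> pM r0; have MT : M^T = M by case: pM.
set a := dotv c (xs + u) + d; set b := dotv c v.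
set A := delta ^+ 2 + _ in r0 *; set B := dotv v (M *m u).
pose C := dotv v (M *m v).
pose g : R -> R := (cst a + b *: id) -
   (Num.sqrt \o (cst A + (2 * B) *: id + C *: (id ^+ 2))).
have gE h : hyper c xs d delta M (h *: v + (xs + u)) = g h.
  rewrite /g /hyper -[RHS]/(a + b * h - Num.sqrt (A + 2 * B * h + C * h ^+ 2)).
  congr (_ - Num.sqrt _).
    rewrite dotvDr dotvZr /a /b; ring.
  have -> : h *: v + (xs + u) - xs = h *: v + 1 *: u.
    by rewrite scale1r (addrC xs) addrA addrK.
  rewrite quad_lincomb // /A /B /C; ring.
have -> : 'D_v (hyper c xs d delta M) (xs + u) = 'D_1 g 0.
  rewrite /derive; set g1 := fun h => h^-1 *: _; set g2 := fun h => h^-1 *: _.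
  suff -> : g1 = g2 by [].
  apply/funext => h; rewrite /g1 /g2 /=.
  by rewrite !gE addr0 -(gE 0) scale0r add0r [h *: 1]mulr1.
have sA : Num.sqrt A != 0 by rewrite gt_eqF // sqrtr_gt0.
pose r : R -> R := cst A + (2 * B) *: id + C *: (id ^+ 2).
have rE : r 0 = A by rewrite -[LHS]/(A + 2 * B * 0 + C * 0 ^+ 2); ring.
have dr : is_derive (0 : R) 1 r (2 * B).
  have d1 : is_derive (0 : R) 1 ((2 * B) *: (id : R -> R)) ((2 * B) *: 1).
    exact: is_deriveZ.
  have d2 : is_derive (0 : R) 1 ((id : R -> R) ^+ 2) ((2 * 0 ^+ 1) *: 1).
    exact: is_deriveX.
  have d3 : is_derive (0 : R) 1 (C *: ((id : R -> R) ^+ 2))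
      (C *: ((2 * 0 ^+ 1) *: 1)) by exact: is_deriveZ.
  have d4 : is_derive (0 : R) 1 (cst A + (2 * B) *: (id : R -> R))
      (0 + (2 * B) *: 1) by exact: is_deriveD.
  apply: is_derive_eq (is_deriveD d4 d3) _.
  by rewrite expr1 mulr0 scale0r scaler0 addr0 add0r [LHS]mulr1.
have ds : is_derive (0 : R) 1 (Num.sqrt \o r) ((2 * Num.sqrt A)^-1 * (2 * B)).
  by apply: is_derive1_comp; rewrite rE; exact: is_derive1_sqrt.
have da : is_derive (0 : R) 1 (cst a + b *: id) b.
  have d1 : is_derive (0 : R) 1 (b *: (id : R -> R)) (b *: 1).
    exact: is_deriveZ.
  have d2 : is_derive (0 : R) 1 (cst a + b *: (id : R -> R)) (0 + b *: 1).
    exact: is_deriveD.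
  apply: is_derive_eq d2 _.
  by rewrite add0r [LHS]mulr1.
have dg : is_derive (0 : R) 1 g (b - (2 * Num.sqrt A)^-1 * (2 * B)).
  exact: is_deriveB.
rewrite derive_val; field; exact: sA.
Qed.

Lemma gradient_hyper_eq0 (R : realType) (n : nat) (c xs : 'cV[R]_n)
    (d delta : R) (M : 'M[R]_n) (u : 'cV[R]_n) : posdef M ->
  let s := Num.sqrt (delta ^+ 2 + dotv u (M *m u)) in
  0 < s ->
  gradient (hyper c xs d delta M) (xs + u) = 0 <-> u = s *: (invmx M *m c).
Proof.
move=> pM s s0.
have r0 : 0 < delta ^+ 2 + dotv u (M *m u) by rewrite -sqrtr_gt0.
have -> : gradient (hyper c xs d delta M) (xs + u) = c - s^-1 *: (M *m u).
  apply/matrixP => i j; rewrite ord1 mxE hyper_derive // dotv_delta.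
  by rewrite dotvC dotv_delta -/s !mxE mulrC.
have Mu := posdef_unitmx pM.
split=> [/eqP|->].
  rewrite subr_eq0 => /eqP ->; rewrite -scalemxAr scalerA mulfV ?gt_eqF //.
  by rewrite scale1r mulKmx.
by rewrite -scalemxAr scalerA mulVf ?gt_eqF // scale1r mulKVmx // subrr.
Qed.

Lemma critical_hyper (R : realType) (n : nat) (c xs : 'cV[R]_n)
    (d delta : R) (M : 'M[R]_n) (u : 'cV[R]_n) : posdef M ->
  let s := Num.sqrt (delta ^+ 2 + dotv u (M *m u)) in
  0 < s ->
  critical_point (hyper c xs d delta M) (xs + u) <-> u = s *: (invmx M *m c).
Proof.
move=> pM s s0; rewrite -(gradient_hyper_eq0 c xs d pM) //.
split=> [[nd|//]|]; last by right.
case: nd; apply: hyper_differentiable.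
by rewrite (addrC xs) addrK -sqrtr_gt0.
Qed.

(** The difference quotient is 1 on the right of 0 and -1 on the left, so no
    limit can be within 1 of both. *)
Lemma norm_not_derivable (R : realType) : ~ derivable (fun h : R => `|h|) 0 1.
Proof.
move=> /cvg_ex [l /cvgrPdist_lt /(_ 1 ltr01)].
case => e /= e0 he.
have /= := he (e / 2); have /= := he (- (e / 2)).
rewrite !sub0r !normrN !(@ger0_norm _ (e / 2)) ?divr_ge0 1?ltW //.
rewrite !ltr_pdivrMr // !oppr_eq0 !mulf_neq0 ?gt_eqF // ?invr_eq0 //.
rewrite ltr_pMr // ltr1n => /(_ isT isT) h1 /(_ isT isT) h2.
have e2 : 0 < e / 2 by rewrite divr_gt0.
have q1 : (e / 2)^-1 * (e / 2) = 1 by rewrite mulVf ?gt_eqF.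
move: h1 h2; rewrite /GRing.scale /= !mulr1 !addr0 normr0 !subr0 normrN.
rewrite (gtr0_norm e2) invrN mulNr q1 opprK !ltr_norml.
move=> /andP[_ l1] /andP[l2 _].
move: l1; rewrite ltNge => /negP; apply; rewrite lerDr.
by move: l2; rewrite ltrBrDl subrr => /ltW.
Qed.

(** If f were differentiable at x_*, then the absolute value, which for v <> 0
    is an affine function of h minus f (x_* + h v), up to the factor
    1 / sqrt (v^T M v), would be derivable at 0.  Positivity of n provides such
    a v. *)
Lemma hyper_not_differentiable (R : realType) (n : nat) (c xs : 'cV[R]_n)
    (d : R) (M : 'M[R]_n) : (0 < n)%N -> posdef M ->
  ~ differentiable (hyper c xs d 0 M) xs.
Proof.
move=> n0 pM dh.
pose v : 'cV[R]_n := delta_mx (Ordinal n0) 0.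
have v0 : v != 0.
  apply/eqP => /matrixP /(_ (Ordinal n0) 0) /eqP.
  by rewrite !mxE !eqxx oner_eq0.
set s := Num.sqrt (dotv v (M *m v)).
have s0 : 0 < s by rewrite sqrtr_gt0 posdef_gt0.
have /derivable1P {}dh := @diff_derivable _ _ _ _ _ v dh.
apply: (@norm_not_derivable R).
have -> : (fun h : R => `|h|) =
    s^-1 *: ((cst (dotv c xs + d) + dotv (invmx M *m c) (M *m v) *: id)
             - (fun h : R => hyper c xs d 0 M (h *: v + xs))).
  apply/funext => h.
  rewrite -[RHS]/(s^-1 * (dotv c xs + d + dotv (invmx M *m c) (M *m v) * h
    - hyper c xs d 0 M (h *: v + xs))).
  rewrite (addrC _ xs) hyper_shift // -!scalemxAr dotvZl !dotvZr.
  rewrite expr0n add0r mulrA -expr2 sqrtrM ?sqr_ge0 // sqrtr_sqr -/s.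
  have sn : s != 0 by rewrite gt_eqF.
  by field.
have d0 : derivable (cst (dotv c xs + d) : R -> R) 0 1 by exact: derivable_cst.
have d1 : derivable (dotv (invmx M *m c) (M *m v) *: (id : R -> R)) 0 1.
  by apply: derivableZ; exact: derivable_id.
exact: derivableZ (derivableB (derivableD d0 d1) dh).
Qed.

(** * Bounds and critical points *)

Lemma dual_quad (R : realType) (n : nat) (c : 'cV[R]_n) (M : 'M[R]_n) :
  posdef M ->
  dotv (invmx M *m c) (M *m (invmx M *m c)) = dotv c (invmx M *m c).
Proof. by move=> pM; rewrite mulKVmx ?posdef_unitmx // dotvC. Qed.

Lemma hyper_ray (R : realType) (n : nat) (c xs : 'cV[R]_n) (d delta t : R)
    (M : 'M[R]_n) : posdef M ->
  let q := dotv c (invmx M *m c) in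
  hyper c xs d delta M (xs + t *: (invmx M *m c)) =
    dotv c xs + d + (t * q - Num.sqrt (delta ^+ 2 + t ^+ 2 * q)).
Proof.
move=> pM q; rewrite hyper_shift // -scalemxAr dotvZl !dotvZr.
by rewrite dual_quad // mulrA -expr2.
Qed.

(** The Cauchy-Schwarz inequality in the plane for (sqrt p, delta) and the unit
    vector (sqrt q, sqrt (1 - q)); the difference of the squares is the square
    of the determinant of the two vectors. *)
Lemma plane_cauchy_schwarz (R : realType) (q delta p : R) :
  0 <= q -> q <= 1 -> 0 <= p ->
  Num.sqrt q * Num.sqrt p + Num.sqrt (1 - q) * delta
    <= Num.sqrt (delta ^+ 2 + p).
Proof.
move=> q0 q1 p0.
have := sqr_sqrtr q0; have := sqr_sqrtr p0.
have : Num.sqrt (1 - q) ^+ 2 = 1 - q by rewrite sqr_sqrtr // subr_ge0.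
set a := Num.sqrt q; set x := Num.sqrt p; set b := Num.sqrt (1 - q).
move=> b2 x2 a2; apply: le_trans (ler_norm _) _.
rewrite -sqrtr_sqr ler_wsqrtr // -subr_ge0.
have -> : delta ^+ 2 + p - (a * x + b * delta) ^+ 2 = (a * delta - b * x) ^+ 2.
  have -> : (a * x + b * delta) ^+ 2 = a ^+ 2 * x ^+ 2
      + 2 * (a * x * b * delta) + b ^+ 2 * delta ^+ 2 by ring.
  have -> : (a * delta - b * x) ^+ 2 = a ^+ 2 * delta ^+ 2
      - 2 * (a * x * b * delta) + b ^+ 2 * x ^+ 2 by ring.
  rewrite a2 x2 b2; ring.
exact: sqr_ge0.
Qed.

(** Cauchy-Schwarz for the inner product of M against w, then in the plane. *)
Lemma hyper_le (R : realType) (n : nat) (c xs x : 'cV[R]_n) (d delta : R)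
    (M : 'M[R]_n) : posdef M ->
  let q := dotv c (invmx M *m c) in q <= 1 ->
  hyper c xs d delta M x <= dotv c xs + d - delta * Num.sqrt (1 - q).
Proof.
move=> pM q q1.
have -> : x = xs + (x - xs) by rewrite addrC subrK.
set u := x - xs; rewrite hyper_shift // lerD2l.
have := posdef_cauchy_schwarz (invmx M *m c) u pM; rewrite dual_quad // -/q.
have q0 : 0 <= q by rewrite /q -dual_quad // posdef_ge0.
have := plane_cauchy_schwarz delta q0 q1 (posdef_ge0 u pM).
rewrite (mulrC delta); lra.
Qed.

(** Since sqrt (delta^2 + t^2 q) <= delta + t * sqrt q for t >= 0, on the line
    directed by w the function is at least t (q - sqrt q) - delta up to a
    constant, and q - sqrt q > 0. *)
Lemma hyper_unbounded (R : realType) (n : nat) (c xs : 'cV[R]_n) (d delta : R)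
    (M : 'M[R]_n) : posdef M -> 0 <= delta ->
  1 < dotv c (invmx M *m c) -> ~ bounded_above (hyper c xs d delta M).
Proof.
move=> pM delta0; set q := dotv c _ => q1 [B ubB].
set k := dotv c xs + d.
have q0 : 0 <= q by rewrite ltW // (lt_trans ltr01).
set a := Num.sqrt q; have a2 : a ^+ 2 = q by exact: sqr_sqrtr.
have a0 : 0 <= a by exact: sqrtr_ge0.
have a1 : 1 < a by rewrite -sqrtr1 /a ltr_sqrt // (lt_trans ltr01).
have qa : 0 < q - a by rewrite -a2 subr_gt0 expr2 ltr_pMl // (lt_trans ltr01).
(* At this t the lower bound t (q - a) - delta is at least B - k + 1. *)
pose t := (`|B - k| + delta + 1) / (q - a).
have t0 : 0 <= t by rewrite divr_ge0 ?(ltW qa) // !addr_ge0.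
have := ubB _ (imageT _ (xs + t *: (invmx M *m c))).
rewrite hyper_ray // -/q -/k.
have st : Num.sqrt (delta ^+ 2 + t ^+ 2 * q) <= delta + t * a.
  rewrite -(ger0_norm (addr_ge0 delta0 (mulr_ge0 t0 a0))).
  rewrite -sqrtr_sqr ler_wsqrtr // -a2 -subr_ge0.
  have -> : (delta + t * a) ^+ 2 - (delta ^+ 2 + t ^+ 2 * a ^+ 2)
    = 2 * (delta * (t * a)) by ring.
  by rewrite mulr_ge0 // mulr_ge0 // mulr_ge0.
have te : t * q - t * a = `|B - k| + delta + 1.
  by rewrite -mulrBr mulfVK // gt_eqF.
have := ler_norm (B - k); lra.
Qed.

(** The condition on s says that delta^2 + (s w)^T M (s w) = s^2: the square
    root takes the value s at x_* + s w, as the equation u = s w for a critical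
    point demands. *)
Lemma critical_hyper_ray (R : realType) (n : nat) (c xs : 'cV[R]_n)
    (d delta s : R) (M : 'M[R]_n) : posdef M ->
  0 < s -> s ^+ 2 * (1 - dotv c (invmx M *m c)) = delta ^+ 2 ->
  critical_point (hyper c xs d delta M) (xs + s *: (invmx M *m c)).
Proof.
move=> pM s0 sE.
have sQ : Num.sqrt (delta ^+ 2 + dotv (s *: (invmx M *m c))
    (M *m (s *: (invmx M *m c)))) = s.
  rewrite -scalemxAr dotvZl dotvZr dual_quad // -sE.
  rewrite [X in Num.sqrt X](_ : _ = s ^+ 2); last by ring.
  by rewrite sqrtr_sqr gtr0_norm.
by apply/critical_hyper => //; rewrite sQ.
Qed.

(** Taking M-norms in u = s w, where s^2 = delta^2 + u^T M u, forces
    s^2 = delta^2 + s^2 q.  The assumption on x keeps s away from 0. *)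
Lemma critical_hyper_on_ray (R : realType) (n : nat) (c xs x : 'cV[R]_n)
    (d delta : R) (M : 'M[R]_n) : posdef M ->
  0 < delta \/ x != xs ->
  critical_point (hyper c xs d delta M) x ->
  exists s, [/\ 0 < s, x = xs + s *: (invmx M *m c)
    & s ^+ 2 * (1 - dotv c (invmx M *m c)) = delta ^+ 2].
Proof.
move=> pM dx; set u := x - xs.
have xE : x = xs + u by rewrite addrC subrK.
rewrite xE; set r := delta ^+ 2 + dotv u (M *m u).
have r0 : 0 < r.
  case: dx => [delta0|xxs].
    by rewrite ltr_wpDr ?posdef_ge0 // exprn_gt0.
  by rewrite ltr_wpDl ?sqr_ge0 // posdef_gt0 // subr_eq0.
move/critical_hyper => /(_ pM); rewrite -/r sqrtr_gt0 => /(_ r0) uE.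
exists (Num.sqrt r); split; rewrite ?sqrtr_gt0 -?uE //.
have : Num.sqrt r ^+ 2 = r by rewrite sqr_sqrtr // ltW.
rewrite {2}/r {1 2}uE -scalemxAr dotvZl dotvZr dual_quad //.
set t := Num.sqrt r => tE; rewrite mulrBr mulr1 {1}tE; ring.
Qed.

(** A maximum would be f_0 + e with e < 0, because the bound of Cauchy-Schwarz
    is strict once delta > 0.  On the other hand t - sqrt (delta^2 + t^2) tends
    to 0, and it already exceeds e at t = delta^2 / - e. *)
Lemma hyper_no_max (R : realType) (n : nat) (c xs : 'cV[R]_n) (d delta : R)
    (M : 'M[R]_n) : posdef M -> 0 < delta -> dotv c (invmx M *m c) = 1 ->
  ~ exists v, global_max_value (hyper c xs d delta M) v.
Proof.
move=> pM delta0 q1 [v [[x _ <-] ub]].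
have xE : x = xs + (x - xs) by rewrite addrC subrK.
set u := x - xs in xE; set k := dotv c xs + d.
have cs := posdef_cauchy_schwarz (invmx M *m c) u pM.
rewrite dual_quad // q1 sqrtr1 mul1r in cs.
have ss : Num.sqrt (dotv u (M *m u)) < Num.sqrt (delta ^+ 2 + dotv u (M *m u)).
  by rewrite ltr_sqrt ?ltr_pwDl ?exprn_gt0 // posdef_ge0.
have := hyper_shift c xs d delta u pM; rewrite -xE -/k.
set e := _ - Num.sqrt _ => fE.
have e0 : 0 < - e by rewrite /e; lra.
pose t := delta ^+ 2 / - e.
have tE : t * - e = delta ^+ 2 by rewrite mulfVK // gt_eqF.
have := ub _ (imageT _ (xs + t *: (invmx M *m c))).
rewrite hyper_ray // fE lerD2l q1 !mulr1.
have t0 : 0 <= t by rewrite divr_ge0 ?sqr_ge0 // ltW.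
have := sqr_sqrtr (addr_ge0 (sqr_ge0 delta) (sqr_ge0 t)).
have := sqrtr_ge0 (delta ^+ 2 + t ^+ 2); set z := Num.sqrt _ => z0 z2 h.
have : (t - e) ^+ 2 <= z ^+ 2.
  by rewrite ler_sqr ?nnegrE //; lra.
rewrite z2 -tE.
have : 0 < e ^+ 2 by rewrite -sqrrN exprn_gt0.
have : 0 <= t * - e by rewrite tE sqr_ge0.
rewrite !expr2; lra.
Qed.

Theorem theorem14 (R : realType) (n : nat) (hn : (0 < n)%N)
    (c xs : 'cV[R]_n) (d delta : R) (hdelta : 0 <= delta)
    (M : 'M[R]_n) (hM : posdef M)
    (f : 'cV[R]_n -> R)
    (hf : forall x, f x = dotv c x + d
       - Num.sqrt (delta ^+ 2 + dotv (x - xs) (M *m (x - xs)))) :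
  let q := dotv c (invmx M *m c) in
  [/\ bounded_above f <-> q <= 1,
   (* (1) *)
      q < 1 -> delta = 0 ->
        [/\ unique (critical_point f) xs,
            f xs = dotv c xs + d
          & global_max_value f (f xs)],
   (* (2) *)
      q = 1 -> delta = 0 ->
        [/\ forall t : R, 0 <= t ->
              critical_point f (xs + t *: (invmx M *m c)),
            forall t : R, 0 <= t -> f (xs + t *: (invmx M *m c)) = f xs,
            f xs = dotv c xs + d
          & global_max_value f (f xs)],
   (* (3) *)
      1 < q -> delta = 0 ->
        unique (critical_point f) xs /\ ~ bounded_above f
    & [/\
   (* (4) *)
      q < 1 -> 0 < delta ->
        let xcp := xs + (delta / Num.sqrt (1 - q)) *: (invmx M *m c) in
        [/\ unique (critical_point f) xcp,
            f xcp = dotv c xs + d - delta * Num.sqrt (1 - q)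
          & global_max_value f (f xcp)],
   (* (5) *)
      q = 1 -> 0 < delta ->
        [/\ forall x, ~ critical_point f x,
            ~ (exists v : R, global_max_value f v)
          & ubound (range f) (dotv c xs + d)]
   (* (6) *)
    & 1 < q -> 0 < delta ->
        (forall x, ~ critical_point f x) /\ ~ bounded_above f]].
Proof.
move=> q.
have {hf} -> : f = hyper c xs d delta M by apply/funext => x; rewrite hf.
have ub : q <= 1 -> ubound (range (hyper c xs d delta M))
    (dotv c xs + d - delta * Num.sqrt (1 - q)).
  by move=> q1 _ [x _ <-]; exact: hyper_le.
have ub0 : delta = 0 -> q <= 1 ->
    ubound (range (hyper c xs d delta M)) (dotv c xs + d).
  move=> delta0 /ub; have -> : delta * Num.sqrt (1 - q) = 0.
    by rewrite delta0 mul0r.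
  by rewrite subr0.
have hxs : delta = 0 -> hyper c xs d delta M xs = dotv c xs + d.
  move=> ->; have := hyper_ray c xs d 0 0 hM.
  by rewrite /= scale0r addr0 expr0n /= !mul0r addr0 sqrtr0 subrr addr0.
have crit0 : delta = 0 -> critical_point (hyper c xs d delta M) xs.
  by move=> ->; left; exact: hyper_not_differentiable.
have uniq0 : q <> 1 -> delta = 0 ->
    unique (critical_point (hyper c xs d delta M)) xs.
  move=> q1 delta0; split=> [|y cy]; first exact: crit0.
  have [//|yxs] := eqVneq y xs.
  have [s [s0 _ /eqP]] := critical_hyper_on_ray hM (or_intror yxs) cy.
  rewrite delta0 expr0n mulf_eq0 sqrf_eq0 gt_eqF //= subr_eq0 => /eqP /esym.
  by move/q1.
have nocrit : 1 <= q -> 0 < delta ->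
    forall x, ~ critical_point (hyper c xs d delta M) x.
  move=> q1 delta0 x /(critical_hyper_on_ray hM (or_introl delta0)).
  move=> [s [s0 _ sE]]; have : 0 < s ^+ 2 * (1 - q) by rewrite sE exprn_gt0.
  by rewrite pmulr_rgt0 ?exprn_gt0 // subr_gt0 ltNge q1.
split.
- split=> [bf|/ub uf]; last by eexists; exact: uf.
  rewrite leNgt; apply/negP => q1.
  exact: (hyper_unbounded hM hdelta q1 bf).
- move=> q1 delta0; split; [|exact: hxs|].
    by apply: uniq0 => //; apply/eqP; rewrite lt_eqF.
  split; first exact: imageT.
  by rewrite hxs //; exact: ub0 (ltW q1).
- move=> q1 delta0; split; [| |exact: hxs|].
  + move=> t; rewrite le_eqVlt => /predU1P[<-|t0].
      by rewrite scale0r addr0; exact: crit0.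
    apply: critical_hyper_ray => //.
    by rewrite -/q q1 delta0 subrr mulr0 expr0n.
  + move=> t t0; rewrite hxs // hyper_ray // -/q q1 delta0 expr0n add0r !mulr1.
    by rewrite sqrtr_sqr ger0_norm // subrr addr0.
  + split; first exact: imageT.
    by rewrite hxs //; apply: ub0 => //; rewrite q1.
- move=> q1 delta0; split; last exact: hyper_unbounded.
  by apply: uniq0 => //; apply/eqP; rewrite gt_eqF.
- split.
  + move=> q1 delta0 xcp; set b := Num.sqrt (1 - q) in xcp *.
    have b0 : 0 < b by rewrite sqrtr_gt0 subr_gt0.
    have b2 : b ^+ 2 = 1 - q by rewrite sqr_sqrtr // subr_ge0 ltW.
    have bn : b != 0 by rewrite gt_eqF.
    have fx : hyper c xs d delta M xcp = dotv c xs + d - delta * b.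
      rewrite hyper_ray // -/q; have -> : q = 1 - b ^+ 2 by rewrite b2; ring.
      rewrite [X in Num.sqrt X](_ : _ = (delta / b) ^+ 2); last by field.
      by rewrite sqrtr_sqr ger0_norm ?divr_ge0 // ?(ltW b0) //; field.
    split=> //; last by split; [exact: imageT|rewrite fx; exact: ub (ltW q1)].
    split=> [|y /(critical_hyper_on_ray hM (or_introl delta0))].
      apply: critical_hyper_ray; rewrite ?divr_gt0 // -/q -b2; by field.
    move=> [s [s0 -> sE]]; congr (_ + _ *: _).
    apply/eqP; rewrite -(@eqrXn2 _ 2) ?divr_ge0 // ?(ltW b0) ?(ltW s0) //.
    by rewrite expr_div_n -sE -/q -b2 mulfK // expf_neq0.
  + move=> q1 delta0; split.
    * by apply: nocrit => //; rewrite q1.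
    * exact: hyper_no_max.
    * by have := ub; rewrite q1 subrr sqrtr0 mulr0 subr0; apply.
  + move=> q1 delta0; split; last exact: hyper_unbounded.
    by apply: nocrit => //; exact: ltW.
Qed.
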